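(* Let $G$ be a connected graph. Then the following two statements hold. (i) $G$ has an $H$-factor for every function $H:V(G)\to\{\{1\},\{0,2\}\}$ with $|H^{-1}(1)|$ even if and only if $$\omega(G-S)\le |S|+1 \quad\text{for all } S\subseteq V(G).$$ (ii) $G$ is $H$-critical for every function $H:V(G)\to\{\{1\},\{0,2\}\}$ with $|H^{-1}(1)|$ odd if and only if $$\omega(G-S)\le |S| \quad\text{for all } \emptyset\ne S\subseteq V(G).$$
   Context: All graphs are finite and simple (no loops, no multiple edges). $V(G)$ is the vertex set of $G$, $\deg_F(v)$ is the degree of $v$ in $F$, $\omega(G)$ is the number of connected components of $G$ (the graph with no vertices has $0$ components), and $G-S$ is the graph obtained from $G$ by deleting the vertices of $S$. Let $H:V(G)\to\{\{1\},\{0,2\}\}$ be a set-valued function, so each $H(v)$ is either the set $\{1\}$ or the set $\{0,2\}$. Write $H^{-1}(1):=\{v\in V(G): H(v)=\{1\}\}$. A spanning subgraph $F$ of $G$ is an $H$-factor of $G$ if $\deg_F(v)\in H(v)$ for all $v\in V(G)$. For a vertex $x$ of $G$, let $G^x$ be the graph obtained from $G$ by adding one new vertex $x'$ together with the new edge $xx'$. Define $H^x:V(G^x)\to\{\{1\},\{0,2\}\}$ by $H^x(x')=\{1\}$ and $H^x(v)=H(v)$ for $v\in V(G)$. The graph $G$ is $H$-critical if $G^x$ has an $H^x$-factor for every vertex $x$ of $G$. *)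

(* Defs.v *)
From mathcomp Require Import all_boot.
Set Implicit Arguments.
Unset Strict Implicit.
Unset Printing Implicit Defensive.

Record sgraph (V : finType) := SGraph {
  adj :> rel V;
  adj_sym : symmetric adj;
  adj_irrefl : irreflexive adj
}.

Definition connected (V : finType) (G : sgraph V) : Prop :=
  forall u v : V, connect G u v.

Definition omega (V : finType) (G : sgraph V) : nat := n_comp G V.

Definition deg (V : finType) (F : sgraph V) (v : V) : nat := #|[set u | F v u]|.

Section Deletion.
Variables (V : finType) (G : sgraph V) (S : {set V}).

Definition del_rel : rel {v : V | v \notin S} := fun u v => G (val u) (val v).

Lemma del_rel_sym : symmetric del_rel.
Proof. by move=> u v; apply: adj_sym. Qed.

Lemma del_rel_irrefl : irreflexive del_rel.
Proof. by move=> u; apply: adj_irrefl. Qed.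

Definition del : sgraph {v : V | v \notin S} := SGraph del_rel_sym del_rel_irrefl.
End Deletion.

(* The two admissible degree sets {1} and {0,2}; a set-valued function
   V(G) -> {{1},{0,2}} is a function V -> degset. *)
Inductive degset : Type := Deg1 | Deg02.

Definition degs (h : degset) : seq nat :=
  match h with Deg1 => [:: 1] | Deg02 => [:: 0; 2] end.

(* H^{-1}(1) *)
Definition ones (V : finType) (H : V -> degset) : {set V} :=
  [set v | degs (H v) == [:: 1]].

(* Spanning subgraphs of G are the graphs on the same vertex type whose
   adjacency is contained in that of G. *)
Definition has_factor (V : finType) (G : sgraph V) (H : V -> degset) : Prop :=
  exists F : sgraph V, subrel F G /\ forall v : V, deg F v \in degs (H v).

(* G^x: the vertex type is option V, where None is the new vertex x'. *)
Section Pendant.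
Variables (V : finType) (G : sgraph V) (x : V).

Definition pendant_rel : rel (option V) := fun a b =>
  match a, b with
  | Some u, Some v => G u v
  | Some u, None => u == x
  | None, Some v => v == x
  | None, None => false
  end.

Lemma pendant_rel_sym : symmetric pendant_rel.
Proof. by move=> [u|] [v|] //=; apply: adj_sym. Qed.

Lemma pendant_rel_irrefl : irreflexive pendant_rel.
Proof. by move=> [u|] //=; apply: adj_irrefl. Qed.

Definition pendant : sgraph (option V) :=
  SGraph pendant_rel_sym pendant_rel_irrefl.
End Pendant.

Definition pendant_fun (V : finType) (H : V -> degset) : option V -> degset :=
  fun a => match a with Some v => H v | None => Deg1 end.

Definition critical (V : finType) (G : sgraph V) (H : V -> degset) : Prop :=
  forall x : V, has_factor (pendant G x) (pendant_fun H).

(* Main.v *)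
Require Import Defs.
From mathcomp Require Import all_boot.
From mathcomp Require Import zify.

(* An H-factor is, up to cycles, a family of disjoint paths pairing up the
   vertices of A = H^{-1}(1), so sufficiency is an instance of Gallai's A-path
   theorem.  Following Gallai, duplicate the vertices outside A: a perfect
   matching of the resulting graph projects to an H-factor, and otherwise a
   Tutte-Berge barrier projects to a set S violating the condition.  Part (ii)
   is the same statement for G^x.  For necessity, put in A the set S together
   with one vertex from each of |S|+2 (resp. |S|+1) components of G - S: by the
   handshake lemma each of these components sends an edge of the factor to S,
   and every vertex of S takes at most one such edge.

   Odd components are replaced throughout by the classes of a labelling that is
   constant along edges, so that no component has to be computed. *)

Set Implicit Arguments.
Unset Strict Implicit.
Unset Printing Implicit Defensive.

(** * Parity of a finite set under an involution *)

(** The points moved by [m] split into pairs [x], [m x]; the induction removes one such pair at a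
    time. *)
Lemma odd_card_involution (T : finType) (C : {set T}) (m : T -> T) :
  {in C, forall x, m x \in C} -> {in C, forall x, m (m x) = x} ->
  odd #|C| = odd #|[set x in C | m x == x]|.
Proof.
have [n] := ubnP #|C|; elim: n C => // n IHn C leCn mC mK.
have [x /andP[xC mx]|fixC] := pickP [pred x | (x \in C) && (m x != x)]; last first.
  congr (odd _); apply: eq_card => x; rewrite inE; move: (fixC x) => /=.
  by case: (x \in C) => //= /negbFE ->.
have mxC := mC x xC; have mxD : m x \in C :\ x by rewrite !inE mx.
have cardC : #|C| = #|C :\ x :\ m x|.+2.
  by rewrite (cardsD1 x C) xC (cardsD1 (m x) (C :\ x)) mxD.
rewrite cardC /= negbK IHn.
- congr (odd _); apply: eq_card => y; rewrite !inE.
  have [->|_] := eqVneq y x; first by rewrite (negbTE mx) !andbF.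
  have [->|_] := eqVneq y (m x); last by [].
  by rewrite (mK x xC) (eq_sym x) (negbTE mx) !andbF.
- by move: leCn; rewrite cardC; lia.
- move=> y; rewrite !inE => /and3P[ymx yx yC]; rewrite mC // andbT.
  apply/andP; split.
  + by apply: contraNneq yx => /(congr1 m); rewrite !mK // => ->.
  + by apply: contraNneq ymx => <-; rewrite mK.
- by move=> y; rewrite !inE => /and3P[_ _ yC]; apply: mK.
Qed.

(** * Matchings, Gallai's lemma and the Tutte-Berge barrier *)

Section TutteBerge.
Variables (T : finType) (e : rel T).
Hypothesis e_sym : symmetric e.
Implicit Types (W U : {set T}) (m : {ffun T -> T}).

(* A matching is encoded as an involution whose fixed points are the vertices it misses. *)
Definition matching W m : bool :=
  [forall x, (m (m x) == x) && ((m x == x) || (x \in W) && e x (m x))].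

Definition missed W m : {set T} := [set x in W | m x == x].

Lemma matchingP W m :
  reflect ((forall x, m (m x) = x) /\
           (forall x, m x != x -> x \in W /\ e x (m x)))
          (matching W m).
Proof.
apply: (iffP forallP) => [mP | [mK mE] x].
  split=> x; have /andP[/eqP // mK] := mP x.
  by case/orP=> [-> // | /andP[]].
by rewrite mK eqxx; case: eqVneq => //= /mE[-> ->].
Qed.

Lemma matching_in W m x : matching W m -> x \in W -> m x \in W.
Proof.
case/matchingP=> mK mE xW; have [->//|mx] := eqVneq (m x) x.
by have [] := mE (m x); rewrite // mK eq_sym.
Qed.

Lemma odd_missed W m : matching W m -> odd #|missed W m| = odd #|W|.
Proof.
move=> mW; have [mK _] := matchingP _ _ mW.
by rewrite (@odd_card_involution _ W m) // => x; apply: matching_in.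
Qed.

Definition maximum W m : bool :=
  matching W m && [forall n, matching W n ==> (#|missed W m| <= #|missed W n|)].

Lemma maximumP W m :
  reflect (matching W m /\ forall n, matching W n -> #|missed W m| <= #|missed W n|)
          (maximum W m).
Proof.
apply: (iffP andP) => -[mW mmin]; split=> //.
  by move=> n nW; move/forallP/(_ n)/implyP: mmin; apply.
by apply/forallP=> n; apply/implyP; apply: mmin.
Qed.

Lemma maximum_exists W : exists m, maximum W m.
Proof.
have idW : matching W [ffun x => x].
  by apply/matchingP; split=> x; rewrite !ffunE // eqxx.
case: (arg_minnP (fun m => #|missed W m|) idW) => m mW mmin.
by exists m; apply/maximumP.
Qed.

(** Pairs [x] with [y] and frees the former partner of [y]. When [m] misses [x] and covers [y], the
    missed vertex [x] is exchanged for [m y]. *)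
Definition rematch m x y : {ffun T -> T} :=
  [ffun w => if w == x then y else if w == y then x
             else if w == m y then w else m w].

Lemma rematch_matching W m x y : matching W m -> m x = x -> x != y ->
  x \in W -> y \in W -> e x y -> matching W (rematch m x y).
Proof.
case/matchingP=> mK mE mx xy xW yW exy.
have yx : (y == x) = false by rewrite eq_sym (negbTE xy).
apply/matchingP; split=> w; rewrite !ffunE.
  have [->|wx] := eqVneq w x; first by rewrite yx eqxx.
  have [->|wy] := eqVneq w y; first by rewrite eqxx.
  have [wE|wmy] := eqVneq w (m y).
    by rewrite (negbTE wx) (negbTE wy) wE eqxx.
  rewrite mK ifN; last by apply: contra_neq wx => mwx; rewrite -(mK w) mwx.
  rewrite ifN; last by apply: contra_neq wmy => mwy; rewrite -mwy mK.
  by rewrite ifN //; apply: contra_neq wy => /(can_inj mK).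
have [->|wx] := eqVneq w x; first by [].
have [->|wy] := eqVneq w y; first by rewrite e_sym.
by have [->|wmy] := eqVneq w (m y); rewrite ?eqxx //; apply: mE.
Qed.

(** If both ends were missed, rematching [x] with [y] would miss strictly fewer vertices. *)
Lemma maximum_edge W m x y : maximum W m -> x \in W -> y \in W -> x != y ->
  e x y -> m x = x -> m y != y.
Proof.
case/maximumP=> mW mmin xW yW xy exy mx; apply/negP=> /eqP my.
have := mmin _ (rematch_matching mW mx xy xW yW exy); apply/negP.
rewrite -ltnNge; apply: proper_card; apply/properP; split.
  apply/subsetP=> w; rewrite !inE ffunE my => /andP[-> /=].
  have [->|_] := eqVneq w x; first by rewrite mx.
  by have [->|_] := eqVneq w y; first by rewrite my.
by exists x; rewrite !inE ?xW ?mx ?eqxx // ffunE eqxx eq_sym negb_and xy orbT.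
Qed.

(** Gallai's relation: no maximum matching misses both vertices. It is made reflexive so that it
    becomes an equivalence once every vertex of [W] is missed by some maximum matching. *)
Definition coupled W x y : bool :=
  (x == y) || [forall m, maximum W m ==> ~~ ((m x == x) && (m y == y))].

Lemma coupledP W x y :
  reflect (forall m, maximum W m -> m x = x -> m y = y -> x = y) (coupled W x y).
Proof.
apply: (iffP orP) => [[/eqP // | /forallP h] m mW mx my | h].
  by have := h m; rewrite mW mx my !eqxx.
have [->|xy] := eqVneq x y; [by left | right; apply/forallP=> m].
apply/implyP=> mW; apply/negP=> /andP[/eqP mx /eqP my].
by rewrite (h m) ?eqxx in xy.
Qed.

Lemma coupled_sym W x y : coupled W x y = coupled W y x.
Proof.
by apply/coupledP/coupledP=> h m mW mx my; rewrite (h m).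
Qed.

(* Gallai's lemma.  If [M] misses [u] and [v], take [N] missing [t] that agrees
   with [M] as much as possible; a vertex [x != t] missed by [N] only can be
   rematched along [M], which increases the agreement. *)
Lemma coupled_trans W u t v : u \in W -> v \in W -> t \in W ->
  (exists2 m, maximum W m & m t = t) ->
  coupled W u t -> coupled W t v -> coupled W u v.
Proof.
move=> uW vW tW [N0 N0W N0t] /coupledP ut /coupledP tv; apply/coupledP=> M MW Mu Mv.
apply/eqP; case: eqVneq => // uv.
pose agree (N : {ffun T -> T}) := #|[set x | (M x == N x) && (M x != x)]|.
pose P (N : {ffun T -> T}) := maximum W N && (N t == t).
have PN0 : P N0 by rewrite /P N0W N0t eqxx.
case: (arg_maxnP agree PN0) => N /andP[NW /eqP Nt] Nmax.
have tu : t != u by apply: contra_neq uv => tu; rewrite -tu (tv M) ?tu.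
have Mt : M t != t by apply: contra_neq tu => Mt; rewrite (ut M).
have Nu : N u != u by apply: contra_neq tu => Nu; rewrite (ut N).
have Nv : N v != v.
  by apply: contra_neq Mt => Nv; rewrite (tv N).
(* [M] and [N] miss equally many vertices, and [u], [v] are missed by [M] only; so at least two
   vertices are missed by [N] only, and one of them is not [t]. *)
have [x] : exists x, x \in (missed W N :\: missed W M) :\ t.
  apply/set0Pn; rewrite -card_gt0.
  have eqMN : #|missed W M| = #|missed W N|.
    have [/maximumP[mM MN] /maximumP[mN NM]] := (MW, NW).
    by apply/eqP; rewrite eqn_leq MN // NM.
  have : [set u; v] \subset missed W M :\: missed W N.
    by apply/subsetP=> w; rewrite !inE => /orP[]/eqP->;
      rewrite ?uW ?vW ?Mu ?Mv ?eqxx ?(negbTE Nu) ?(negbTE Nv).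
  move/subset_leq_card; rewrite cards2 uv.
  have := cardsID (missed W M) (missed W N); have := cardsID (missed W N) (missed W M).
  rewrite setIC; have := cardsD1 t (missed W N :\: missed W M); lia.
rewrite !inE => /and4P[xt xM xW /eqP Nx]; rewrite xW /= in xM.
have [/maximumP[mM _] /maximumP[mN Nmin]] := (MW, NW).
have [/matchingP[MK ME] /matchingP[NK NE]] := (mM, mN).
have [_ exy] := ME _ xM; set y := M x in xM exy.
have yW : y \in W by apply: matching_in.
have xy : x != y by rewrite eq_sym.
have Ny : N y != y by apply: (maximum_edge NW xW).
have mN' := rematch_matching mN Nx xy xW yW exy.
have ty : t != y by apply: contraNneq Ny => <-; rewrite Nt.
have zx : N y != x by apply: contra_neq xy => zx; rewrite -Nx -zx NK.
(* The rematching misses [N y] in place of [x], hence is still maximum, and it still misses [t]. *)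
have PN' : P (rematch N x y).
  apply/andP; split; last first.
    rewrite ffunE (eq_sym t x) (negbTE xt) (negbTE ty) Nt.
    by case: ifP.
  apply/maximumP; split=> // n nW; apply: leq_trans (Nmin n nW).
  have xN : x \in missed W N by rewrite inE xW Nx eqxx.
  rewrite (cardsD1 x (missed W N)) xN.
  apply: leq_trans (_ : #|N y |: (missed W N :\ x)| <= _); last first.
    by rewrite cardsU1; case: (_ \notin _).
  apply: subset_leq_card; apply/subsetP=> w; rewrite !inE ffunE => /andP[-> /=].
  have [->|wx] := eqVneq w x; first by rewrite eq_sym (negbTE xy).
  have [->|wy] := eqVneq w y; first by rewrite (negbTE xy).
  by have [->|wz] := eqVneq w (N y).
have := Nmax _ PN'; rewrite /geq /= leqNgt => /negP[].
apply: proper_card; apply/properP; split; last first.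
  by exists x; rewrite !inE ?ffunE ?eqxx ?xM // Nx (negbTE xM).
(* An agreement could only be lost at [N y]; but there [M] would give [y], whose partner under [M]
   is [x]. *)
apply/subsetP=> w; rewrite !inE ffunE => /andP[/eqP MNw Mw]; rewrite Mw andbT.
have [->|wx] := eqVneq w x; first by rewrite eqxx.
have [->|wy] := eqVneq w y; first by rewrite MK.
have [wz|wz] := eqVneq w (N y); last by rewrite MNw.
have Mwy : M w = y by rewrite MNw wz NK.
by rewrite -(MK w) Mwy MK eqxx in wx.
Qed.

(** Induction on [#|W|]. A vertex covered by every maximum matching is moved into the barrier. If
    there is none, the barrier is empty and the labels are the classes of [coupled]: adjacent
    vertices are coupled, and a maximum matching misses at most one vertex of each class. *)
Theorem tutte_berge W : exists m U (f : T -> {set T}),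
  [/\ matching W m, U \subset W,
      forall x y, x \in W :\: U -> y \in W :\: U -> e x y -> f x = f y
    & #|missed W m| + #|U| <=
      #|[set k | odd #|[set x in W :\: U | f x == k]|]|].
Proof.
have [n] := ubnP #|W|; elim: n W => // n IHn W ltWn.
have [m mW] := maximum_exists W; have [mm mmin] := maximumP _ _ mW.
have [v /andP[vW vD]|allD] :=
    pickP [pred v in W | [forall n, maximum W n ==> (n v != v)]].
  have ltW' : #|W :\ v| < n by move: ltWn; rewrite (cardsD1 v W) vW; lia.
  have [m' [U [f [mW' UW' fU leU]]]] := IHn _ ltW'.
  have eqD : W :\: (v |: U) = (W :\ v) :\: U.
    by apply/setP=> w; rewrite !inE; do !case: (_ \in _); case: eqP.
  exists m, (v |: U), f; split=> //.
  - by rewrite subUset sub1set vW (subset_trans UW') // subsetDl.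
  - by rewrite eqD.
  rewrite eqD; apply: leq_trans leU; rewrite cardsU1.
  have -> : v \notin U by apply/negP=> /(subsetP UW'); rewrite !inE eqxx.
  have m'W : matching W m'.
    case/matchingP: mW' => mK mE; apply/matchingP; split=> // x /mE[].
    by rewrite !inE => /andP[].
  have m'v : m' v = v.
    case/matchingP: mW' => mK mE; apply/eqP; case: eqVneq => // /mE[].
    by rewrite !inE eqxx.
  have cardm' : #|missed W m'| = #|missed (W :\ v) m'|.+1.
    rewrite (cardsD1 v (missed W m')) inE vW m'v eqxx /=; congr _.+1.
    by apply: eq_card => w; rewrite !inE andbA.
  (* On [W] the matching [m'] also misses [v], so it is not maximum; by parity [m] misses at least
     two vertices fewer, which pays for adding [v] to the barrier. *)
  have := mmin _ m'W; rewrite leq_eqVlt => /orP[/eqP eqm | ltm].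
    have m'max : maximum W m' by apply/maximumP; split=> // k; rewrite -eqm; apply: mmin.
    by move/forallP/(_ m'): vD; rewrite m'max m'v eqxx.
  have := odd_missed mm; rewrite -(odd_missed m'W); move: ltm; rewrite cardm'; lia.
have {}allD v : v \in W -> exists2 k, maximum W k & k v = v.
  move=> vW; have := allD v; rewrite /= vW /= => /negbT; rewrite negb_forall.
  by case/existsP=> k; rewrite negb_imply negbK => /andP[kW /eqP]; exists k.
pose f x := [set y in W | coupled W x y].
have coupledxx x : coupled W x x by rewrite /coupled eqxx.
have fP x y : x \in W -> y \in W -> (f x == f y) = coupled W x y.
  move=> xW yW; apply/eqP/idP=> [/setP/(_ y) | cxy].
    by rewrite !inE yW coupledxx.
  apply/setP=> w; rewrite !inE; case wW: (w \in W) => //=.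
  apply/idP/idP=> h; first by apply: (@coupled_trans W _ x) => //; [exact: allD | rewrite coupled_sym].
  by apply: (@coupled_trans W _ y) => //; exact: allD.
have ef x y : x \in W -> y \in W -> e x y -> f x = f y.
  move=> xW yW exy; apply/eqP; rewrite fP //; apply/coupledP=> k kW kx /eqP ky.
  by apply/eqP; apply: contraTT ky => xy; apply: (maximum_edge kW xW).
exists m, set0, f; split; rewrite ?sub0set ?setD0 //.
rewrite cards0 addn0.
have finj : {in missed W m &, injective f}.
  move=> x y; rewrite !inE => /andP[xW /eqP mx] /andP[yW /eqP my] /eqP.
  by rewrite fP // => /coupledP/(_ m); apply.
rewrite -(card_in_imset finj); apply: subset_leq_card.
apply/subsetP=> _ /imsetP[x xm ->]; rewrite inE.
(* The class of a missed vertex [x] is odd: [m] preserves it and fixes only [x] there. *)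
have [mK mE] := matchingP _ _ mm.
rewrite (@odd_card_involution _ _ m) => [|y|y]; last by rewrite mK.
  rewrite (_ : [set _ in _ | _] = [set x]) ?cards1 //.
  apply/setP=> y; rewrite !inE; apply/idP/eqP=> [/andP[/andP[yW /eqP fyx] my]|->].
    by apply: finj; rewrite // inE yW.
  by move: xm; rewrite inE eqxx => /andP[-> ->].
rewrite !inE => /andP[yW /eqP <-]; rewrite (matching_in mm) //=.
have [->//|/mE[_ emy]] := eqVneq (m y) y.
by apply/eqP/esym/ef=> //; apply: matching_in.
Qed.

End TutteBerge.

(** * Labellings constant along edges and components of [G - S] *)

Lemma connect_invariant (T L : finType) (e : rel T) (f : T -> L) :
  (forall x y, e x y -> f x = f y) -> forall x y, connect e x y -> f x = f y.
Proof.
move=> fe x y /connectP[p]; elim: p x => /= [x _ ->|z p IHp x /andP[xz zp] ly] //.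
by rewrite (fe x z) //; apply: IHp.
Qed.

Lemma label_le_omega (V L : finType) (G : sgraph V) (S : {set V}) (g : V -> L) :
  {in ~: S &, forall u v, G u v -> g u = g v} -> #|g @: ~: S| <= omega (del G S).
Proof.
move=> gG; set D := del G S.
have gD : forall x y, connect D x y -> g (val x) = g (val y).
  apply: (connect_invariant (f := g \o val)) => x y xy.
  by apply: gG xy; rewrite inE; [exact: (valP x) | exact: (valP y)].
apply: leq_trans (_ : #|[set g (val r) | r in roots D]| <= _); last first.
  apply: leq_trans (leq_imset_card _ _) _; apply: subset_leq_card.
  by apply/subsetP=> r rD; rewrite !inE andbT.
apply: subset_leq_card; apply/subsetP=> _ /imsetP[v vS ->].
rewrite inE in vS; pose x : {v | v \notin S} := Sub v vS.
have Dsym : connect_sym D by apply: sym_connect_sym; apply: adj_sym.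
apply/imsetP; exists (root D x); first exact: roots_root.
by apply: gD (connect_root _ x).
Qed.

(** * Duplicated vertices and the projection of perfect matchings *)

Section PairedPaths.
Variables (V : finType) (G : sgraph V) (A : {set V}).

(* Two adjacent copies of every vertex outside [A], one copy of the vertices of
   [A]: a perfect matching of this graph projects to a subgraph of [G] with
   degree 1 on [A] and degree 0 or 2 elsewhere, once double edges are dropped. *)
Definition split_rel : rel (V * bool) :=
  fun p q => G p.1 q.1 || (p.1 == q.1).

Definition split_set : {set V * bool} := [set p | p.2 ==> (p.1 \notin A)].

Lemma split_rel_sym : symmetric split_rel.
Proof. by move=> p q; rewrite /split_rel adj_sym eq_sym. Qed.

(** Swapping the two copies of each vertex outside [A] is an involution that fixes exactly the
    copies of the vertices of [A]. *)
Lemma odd_split_set : odd #|split_set| = odd #|A|.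
Proof.
pose m (p : V * bool) := if p.1 \in A then p else (p.1, ~~ p.2).
rewrite (@odd_card_involution _ _ m).
- rewrite -(card_imset (mem A) (f := fun v => (v, false))); last by move=> u v [].
  congr (odd _); apply: eq_card => -[v b]; rewrite !inE /m /=.
  apply/idP/imsetP=> [|[u uA [-> ->]]]; last by rewrite uA eqxx.
  case: (boolP (v \in A)) => vA; last by rewrite xpair_eqE; case: b; rewrite andbF.
  by case: b => // _; exists v.
- by move=> [v b]; rewrite !inE /m /=; case: ifP => vA; rewrite /= vA; case: b.
- by move=> [v b] _; rewrite /m /=; case vA: (v \in A); rewrite /= vA ?negbK.
Qed.

Section Projection.
Variable m : {ffun V * bool -> V * bool}.
Hypothesis m_matching : matching split_rel split_set m.
Hypothesis m_perfect : missed split_set m = set0.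

(** The exclusive or drops an edge used by both copies of [u]. For [u] in [A] the pair [(u, true)]
    is fixed by [m] and contributes nothing when [u != v]. *)
Definition proj_rel : rel V := fun u v =>
  (u != v) && (((m (u, false)).1 == v) (+) ((m (u, true)).1 == v)).

Let mK : involutive m. Proof. by case: (matchingP _ _ _ m_matching). Qed.

Let m_neq p : p \in split_set -> m p != p.
Proof. by move=> pW; have := in_set0 p; rewrite -m_perfect inE pW /= => /negbT. Qed.

Lemma proj_rel_irrefl : irreflexive proj_rel.
Proof. by move=> u; rewrite /proj_rel eqxx. Qed.

(** For [u != v], both sides are the parity of the number of matched pairs between copies of [u] and
    copies of [v]. *)
Lemma proj_rel_sym : symmetric proj_rel.
Proof.
move=> u v; rewrite /proj_rel eq_sym; case: eqVneq => //= _.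
have step u1 v1 b : ((m (u1, b)).1 == v1) =
    (m (u1, b) == (v1, false)) (+) (m (u1, b) == (v1, true)).
  by case: (m _) => w []; rewrite !xpair_eqE /= ?andbF ?andbT ?addbF.
have flip p q : (m p == q) = (m q == p).
  by apply/eqP/eqP=> <-; rewrite mK.
rewrite !step !(flip (v, _)).
by do 4!case: (m _ == _).
Qed.

Definition proj : sgraph V := SGraph proj_rel_sym proj_rel_irrefl.

Lemma proj_subrel : subrel proj G.
Proof.
have [_ mE] := matchingP _ _ _ m_matching.
have edge u v b : u != v -> (m (u, b)).1 == v -> G u v.
  move=> uv /eqP mv; have /mE[_] : m (u, b) != (u, b).
    by apply: contra_neq uv => mu; rewrite -mv mu.
  by rewrite /split_rel mv /= (negbTE uv) orbF.
move=> u v /andP[uv]; case: eqP => [/eqP muv _|_ /= muv]; exact: edge muv.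
Qed.

Lemma deg_proj_in u : u \in A -> deg proj u = 1.
Proof.
have [_ mE] := matchingP _ _ _ m_matching.
move=> uA; rewrite -(cards1 (m (u, false)).1); apply: eq_card => v; rewrite !inE.
have mt : m (u, true) = (u, true).
  by apply/eqP; apply: contraT => /mE[]; rewrite inE /= uA.
have muu : (m (u, false)).1 != u.
  have : m (u, false) != (u, false) by apply: m_neq; rewrite inE.
  apply: contra_neq; case muf: (m _) => [w []] /= wu; last by rewrite wu.
  by have := mK (u, false); rewrite muf wu mt.
rewrite /= /proj_rel mt /= [v == _]eq_sym.
by case: (eqVneq u v) => /= [<-|uv]; rewrite ?(negbTE muu) ?addbF.
Qed.

(** The neighbours of [u] are the projections [a], [b] of the partners of its two copies. They
    cancel when equal, in particular when the two copies are matched together. *)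
Lemma deg_proj_notin u : u \notin A -> deg proj u \in [:: 0; 2].
Proof.
move=> uA; set a := (m (u, false)).1; set b := (m (u, true)).1.
have m_self c d : (m (u, c)).1 = u -> (m (u, d)).1 = u.
  move=> mcu; have mcn : m (u, c) != (u, c) by apply: m_neq; rewrite inE /= uA implybT.
  have mc : m (u, c) = (u, ~~ c).
    move: mcu mcn; case: (m _) => w d' /= ->; rewrite xpair_eqE eqxx /=.
    by case: c d' => [] [].
  have [->|/negPf dc] := eqVneq d c; first by rewrite mc.
  have -> : d = ~~ c by case: c d dc {mcu mcn mc} => [] [].
  by rewrite -mc mK.
have degE : deg proj u = #|[set v | (u != v) && ((a == v) (+) (b == v))]| by [].
have [ab|ab] := eqVneq a b.
  rewrite degE (_ : [set _ | _] = set0) ?cards0 //.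
  by apply/setP=> v; rewrite !inE ab addbb andbF.
have au : a != u by apply: contra_neq ab => au; rewrite au; apply/esym/(m_self false).
have bu : b != u by apply: contra_neq ab => bu; rewrite bu; apply/(m_self true).
suff -> : deg proj u = #|[set a; b]| by rewrite cards2 ab.
rewrite degE; apply: eq_card => v; rewrite !inE ![v == _]eq_sym.
have [<-|_] := eqVneq u v; first by rewrite /= (negbTE au) (negbTE bu).
by have [<-|_] := eqVneq a v; rewrite //= eq_sym (negbTE ab).
Qed.

End Projection.
End PairedPaths.

(** * Sufficiency: from a barrier to an H-factor *)

Lemma onesE (V : finType) (H : V -> degset) v :
  H v = if v \in ones H then Deg1 else Deg02.
Proof. by rewrite inE; case: (H v). Qed.

(* The weak form of Gallai's A-path theorem: [|S| <= |U|] for the set [S] of the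
   vertices all of whose copies lie in the Tutte-Berge barrier [U], and every
   odd class of [U] is counted by a component of [G - S]; parity closes the gap. *)
Theorem tough_has_factor (V : finType) (G : sgraph V) (H : V -> degset) :
  (forall (L : finType) (S : {set V}) (g : V -> L),
     {in ~: S &, forall u v, G u v -> g u = g v} -> #|g @: ~: S| <= #|S| + 1) ->
  ~~ odd #|ones H| -> has_factor G H.
Proof.
move=> tough evenA; set A := ones H in evenA *.
have [m [U [f [mW UW fU leU]]]] := tutte_berge (split_rel_sym G) (split_set A).
set O := [set k | _] in leU.
have WD (p : V * bool) : p \in split_set A :\: U = (p \notin U) && (p.2 ==> (p.1 \notin A)).
  by rewrite inE [p \in split_set A]inE.
pose S := [set v | ((v, false) \in U) && ((v \in A) || ((v, true) \in U))].
(* For [v] outside [S] this is a copy of [v] outside [U]: the first one, or the second if the first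
   lies in [U]. *)
pose lift v := (v, (v, false) \in U).
have liftW v : v \notin S -> lift v \in split_set A :\: U.
  rewrite WD inE /lift; case vU: ((v, false) \in U); rewrite /= ?vU //.
  by rewrite negb_or andbC.
have leO : #|O| <= #|S| + 1.
  have liftG : {in ~: S &, forall u v, G u v -> f (lift u) = f (lift v)}.
    move=> u v uS vS uv; rewrite !in_setC in uS vS.
    by apply: fU; [exact: liftW | exact: liftW | rewrite /split_rel /= uv].
  apply: leq_trans (tough _ S (f \o lift) liftG).
  apply: subset_leq_card; apply/subsetP=> k; rewrite inE => oddk.
  have /set0Pn[[v b]] : [set x in split_set A :\: U | f x == k] != set0.
    by apply: contraTneq oddk => ->; rewrite cards0.
  rewrite inE => /andP[vbW /eqP <-].
  have vS : v \notin S.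
    move: vbW; rewrite WD [v \in S]inE /=; case: b => /= /andP[/negbTE-> //].
    by move/negbTE->; rewrite andbF.
  apply/imsetP; exists v; first by rewrite in_setC.
  by apply: fU (vbW) (liftW _ vS) _; rewrite /split_rel eqxx orbT.
have leS : #|S| <= #|U|.
  rewrite -(card_imset (mem S) (f := fun v => (v, false))); last by move=> u v [].
  by apply: subset_leq_card; apply/subsetP=> _ /imsetP[v vS ->]; move: vS; rewrite inE => /andP[].
have oddO : odd #|O| = odd #|split_set A :\: U|.
  rewrite -[#|split_set A :\: U|]sum1_card (partition_big f xpredT) //=.
  rewrite (bigID (mem O)) /= oddD.
  rewrite (eq_bigr (fun k => #|[set x in split_set A :\: U | f x == k]|)); last first.
    by move=> k _; rewrite -sum1_card; apply: eq_bigl => x; rewrite [in RHS]inE.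
  rewrite [X in _ (+) odd X](eq_bigr (fun k => #|[set x in split_set A :\: U | f x == k]|)); last first.
    by move=> k _; rewrite -sum1_card; apply: eq_bigl => x; rewrite [in RHS]inE.
  have -> : odd (\sum_(k | k \notin O) #|[set x in split_set A :\: U | f x == k]|) = false.
    by elim/big_rec: _ => // k s; rewrite inE oddD => /negbTE-> ->.
  rewrite addbF -sum1_card.
  by elim/big_rec2: _ => // k s t; rewrite inE !oddD => -> ->.
(* Since [#|A|] is even, [#|O|] and [#|U|] have the same parity, so [#|O| <= #|U| + 1] improves to
   [#|O| <= #|U|] and nothing is missed. *)
have perfect : missed (split_set A) m = set0.
  apply/eqP; rewrite -cards_eq0.
  move: oddO; rewrite cardsD (setIidPr UW) oddB ?subset_leq_card // odd_split_set.
  rewrite (negbTE evenA) /=; move: leU leO leS; clear.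
  by move: #|O| #|U| #|S| #|missed _ _| => o u s k; lia.
exists (proj mW); split; first exact: proj_subrel.
move=> v; rewrite [H v]onesE -/A; case: ifP => vA /=.
  by rewrite (deg_proj_in mW perfect vA).
by apply: (deg_proj_notin mW perfect); rewrite vA.
Qed.

(** * Necessity: factors and separating sets *)

(* By the handshake lemma every class met by [R] sends an edge of [F] to [S], and
   vertices of [S] have at most one neighbour. *)
Lemma factor_separator (X L : finType) (F : sgraph X) (S R : {set X}) (f : X -> L) :
  {in ~: S &, forall x y, F x y -> f x = f y} ->
  [disjoint R & S] -> {in R &, injective f} ->
  {in S, forall x, deg F x <= 1} -> {in R, forall x, odd (deg F x)} ->
  {in R, forall r x, x \notin S -> f x = f r -> x != r -> ~~ odd (deg F x)} ->
  #|R| <= #|S|.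
Proof.
move=> fF dRS finj degS degR degC.
pose hits r s := [exists x, [&& x \notin S, f x == f r & F x s]].
have cross r : r \in R -> [exists s in S, hits r s].
  move=> rR; have rS : r \notin S by rewrite (disjointFr dRS rR).
  apply: contraT => /exists_inPn noS.
  (* If no edge leaves the class [C] of [r] towards [S], then [C] is closed under [F] and its degree
     sum is even, by swapping the ordered pairs in [P]; yet [r] is its only vertex of odd degree. *)
  pose C := [set x | (x \notin S) && (f x == f r)].
  have CF x y : x \in C -> F x y -> y \in C.
    rewrite !inE => /andP[xS fx] Fxy.
    have yS : y \notin S.
      by apply/negP=> /noS /existsP[]; exists x; rewrite xS fx.
    by rewrite yS -(eqP fx) (fF x y) ?in_setC ?eqxx.
  pose P := [set p : X * X | (p.1 \in C) && F p.1 p.2].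
  have evenP : odd #|P| = false.
    rewrite (@odd_card_involution _ P (fun p => (p.2, p.1))).
    - rewrite (_ : [set _ in _ | _] = set0) ?cards0 //.
      apply/setP=> -[x y]; rewrite !inE /= xpair_eqE.
      by case: (eqVneq y x) => [->|]; rewrite ?adj_irrefl ?andbF.
    - move=> [x y]; rewrite ![_ \in P]inE /= => /andP[xC Fxy].
      by rewrite (CF x y) // adj_sym.
    - by move=> [x y].
  have cardP : #|P| = \sum_(x in C) deg F x.
    rewrite -sum1_card (eq_bigl (fun p => (p.1 \in C) && F p.1 p.2)); last first.
      by move=> p; rewrite [p \in P]inE.
    rewrite -(pair_big_dep (mem C) (fun x y => F x y) (fun _ _ => 1)) /=.
    by apply: eq_bigr => x _; rewrite sum1dep_card.
  have rC : r \in C by rewrite inE rS eqxx.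
  move: evenP; rewrite cardP (bigD1 r) //= oddD degR //.
  suff -> : odd (\sum_(x in C | x != r) deg F x) = false by [].
  elim/big_rec: _ => // x k /andP[]; rewrite inE => /andP[xS /eqP fx] xr.
  by rewrite oddD => ->; rewrite (negbTE (degC r rR x xS fx xr)).
(* The default [r] only makes [h] total. *)
pose h r := odflt r [pick s in S | hits r s].
have hP r : r \in R -> h r \in S /\ hits r (h r).
  move=> /cross/exists_inP[s sS rs]; rewrite /h.
  by case: pickP => [t /andP[]|/(_ s)] //=; rewrite sS rs.
have hinj : {in R &, injective h}.
  move=> r r' rR r'R hrr'; apply: finj => //.
  have [hS /existsP[x /and3P[_ /eqP <- Fx]]] := hP r rR.
  have [_ /existsP[y /and3P[_ /eqP <- Fy]]] := hP r' r'R.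
  congr f; apply: (card_le1_eqP (degS _ hS)); rewrite inE adj_sym //.
  by rewrite hrr'.
rewrite -(card_in_imset hinj); apply: subset_leq_card.
by apply/subsetP=> _ /imsetP[r rR ->]; have [] := hP r rR.
Qed.

Lemma subset_of_card (T : finType) (A : {set T}) k :
  k <= #|A| -> exists2 B : {set T}, B \subset A & #|B| = k.
Proof.
elim: k => [|k IHk] ltkA; first by exists set0; rewrite ?sub0set ?cards0.
have [B BA Bk] := IHk (ltnW ltkA).
have /properP[_ [x xA xB]] : B \proper A by rewrite properEcard BA Bk.
by exists (x |: B); rewrite ?cardsU1 ?xB ?Bk // subUset sub1set xA.
Qed.

(** The label of a vertex outside [S] is the root of its component, vertices of [S] get [None], and
    [R] consists of [k] of the roots. *)
Lemma component_representatives (V : finType) (G : sgraph V) (S : {set V}) k :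
  k <= omega (del G S) ->
  exists (L : finType) (f : V -> L) (R : {set V}),
    [/\ {in ~: S &, forall u v, G u v -> f u = f v}, [disjoint R & S],
        {in R &, injective f} & #|R| = k].
Proof.
set D := del G S => lek.
have Dsym : connect_sym D by apply: sym_connect_sym; apply: adj_sym.
have [Q QD cardQ] : exists2 Q : {set {v | v \notin S}},
    Q \subset [set r in roots D] & #|Q| = k.
  apply: subset_of_card; apply: leq_trans lek _; apply: subset_leq_card.
  by apply/subsetP=> r; rewrite !inE andbT.
pose f v := omap (root D) (insub v : option {v | v \notin S}).
have fval (x : {v | v \notin S}) : f (val x) = Some (root D x) by rewrite /f valK.
exists _, f, (val @: Q); split.
- move=> u v; rewrite !in_setC => uS vS uv.
  pose x : {v | v \notin S} := Sub u uS; pose y : {v | v \notin S} := Sub v vS.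
  rewrite -[u]/(val x) -[v]/(val y) !fval; congr Some.
  by apply/(rootP Dsym)/connect1.
- rewrite disjoint_subset; apply/subsetP=> _ /imsetP[x _ ->].
  exact: (valP x).
- move=> _ _ /imsetP[x xQ ->] /imsetP[y yQ ->]; rewrite !fval => -[].
  move/subsetP: QD => QD; have := QD x xQ; have := QD y yQ; rewrite !inE.
  by move=> /eqP-> /eqP->  ->.
- by rewrite card_imset //; apply: val_inj.
Qed.

(** * Prescribed degree functions and the two equivalences *)

Definition indicator (V : finType) (A : {set V}) (v : V) : degset :=
  if v \in A then Deg1 else Deg02.

Lemma ones_indicator (V : finType) (A : {set V}) : ones (indicator A) = A.
Proof. by apply/setP=> v; rewrite inE /indicator; case: ifP. Qed.

Lemma ones_pendant (V : finType) (H : V -> degset) :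
  #|ones (pendant_fun H)| = #|ones H|.+1.
Proof.
have -> : ones (pendant_fun H) = None |: Some @: ones H.
  apply/setP=> -[v|]; rewrite !inE /=; last by [].
  by rewrite mem_imset ?inE //; apply: Some_inj.
rewrite cardsU1 card_imset; last exact: Some_inj.
by rewrite (_ : None \notin _) //; apply/imsetP=> -[].
Qed.

Theorem theorem5 (V : finType) (G : sgraph V) (Gconn : connected G) :
  ((forall H : V -> degset, ~~ odd #|ones H| -> has_factor G H)
     <-> (forall S : {set V}, omega (del G S) <= #|S| + 1))
  /\
  ((forall H : V -> degset, odd #|ones H| -> critical G H)
     <-> (forall S : {set V}, S != set0 -> omega (del G S) <= #|S|)).
Proof.
split; split.
- move=> factorG S; rewrite leqNgt; apply/negP; rewrite addn1 => /component_representatives.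
  case=> L [f [R [fG dRS finj cardR]]].
  (* Here [#|R|] is [#|S| + 2], which gives the union the required even size. *)
  have cardA : #|S :|: R| = (#|S|.+1).*2.
    by move: dRS; rewrite disjoint_sym -leq_card_setU => /eqP->; rewrite cardR; lia.
  have [|F [FG degF]] := factorG (indicator (S :|: R)).
    by rewrite ones_indicator cardA odd_double.
  have deg1 x : x \in S :|: R -> deg F x = 1.
    by move=> xA; have := degF x; rewrite /indicator xA inE => /eqP.
  suff : #|R| <= #|S| by rewrite cardR; lia.
  apply: (factor_separator (F := F) (f := f)) => //.
  + by move=> x y xS yS /FG; apply: fG.
  + by move=> x xS; rewrite deg1 // inE xS.
  + by move=> x xR; rewrite deg1 // inE xR orbT.
  + move=> r rR x xS fx xr; have := degF x; rewrite /indicator inE (negbTE xS) /=.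
    have -> : x \in R = false by apply/negP=> xR; rewrite (finj x r) ?eqxx in xr.
    by rewrite !inE => /orP[] /eqP->.
- move=> toughG H evenH; apply: tough_has_factor evenH => L S g gG.
  exact: leq_trans (label_le_omega gG) (toughG S).
- move=> criticalG S /set0Pn[x xS]; rewrite leqNgt; apply/negP=> /component_representatives.
  case=> L [f [R [fG dRS finj cardR]]].
  have cardA : #|S :|: R| = (#|S|.*2).+1.
    by move: dRS; rewrite disjoint_sym -leq_card_setU => /eqP->; rewrite cardR; lia.
  (* The pendant edge is attached at a vertex [x] of [S], so the new vertex touches no component of
     [G - S] and can carry the separate label [None]. *)
  have [|F [FG degF]] := criticalG (indicator (S :|: R)) _ x.
    by rewrite ones_indicator cardA /= odd_double.
  have deg1 v : v \in S :|: R -> deg F (Some v) = 1.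
    by move=> vA; have := degF (Some v); rewrite /= /indicator vA inE => /eqP.
  suff : #|Some @: R| <= #|Some @: S|.
    by rewrite !card_imset; [rewrite cardR; lia | exact: Some_inj | exact: Some_inj].
  have inS v : (Some v \in Some @: S) = (v \in S) by apply: mem_imset; exact: Some_inj.
  apply: (factor_separator (F := F) (f := omap f)).
  + move=> [u|] [v|]; rewrite ?in_setC ?inS => uS vS /FG //=.
    * by move=> uv; rewrite (fG u v) ?in_setC.
    * by move/eqP=> ux; rewrite ux xS in uS.
    * by move/eqP=> vx; rewrite vx xS in vS.
  + rewrite disjoint_subset; apply/subsetP=> _ /imsetP[v vR ->].
    by rewrite inE inS (disjointFr dRS vR).
  + by move=> _ _ /imsetP[u uR ->] /imsetP[v vR ->] [fuv]; rewrite (finj u v).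
  + by move=> _ /imsetP[v vS ->]; rewrite deg1 // inE vS.
  + by move=> _ /imsetP[v vR ->]; rewrite deg1 // inE vR orbT.
  + move=> _ /imsetP[r rR ->] [v|] // ; rewrite inS => vS [fv] vr.
    have := degF (Some v); rewrite /= /indicator inE (negbTE vS) /=.
    have -> : v \in R = false by apply/negP=> vR; rewrite (finj v r) ?eqxx in vr.
    by rewrite !inE => /orP[] /eqP->.
- move=> toughG H oddH x; apply: tough_has_factor; last by rewrite ones_pendant /= oddH.
  move=> L S g gG; pose S0 := [set v | Some v \in S].
  have gG0 : {in ~: S0 &, forall u v, G u v -> g (Some u) = g (Some v)}.
    by move=> u v; rewrite !inE => uS vS uv; apply: gG; rewrite ?inE.
  have leS : #|S0| <= #|S|.
    rewrite -(card_imset (mem S0) (@Some_inj _)); apply: subset_leq_card.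
    by apply/subsetP=> _ /imsetP[v vS ->]; rewrite inE in vS.
  (* If [S0] is nonempty, the new vertex adds at most one label to the at most [#|S0|] labels on
     [G - S0]. *)
  have [S00|S0n0] := eqVneq S0 set0; last first.
    apply: leq_trans (_ : #|g None |: (g \o Some) @: ~: S0| <= _).
      apply: subset_leq_card; apply/subsetP=> _ /imsetP[[v|] vS ->]; rewrite !inE ?eqxx //.
      by apply/orP; right; apply/imsetP; exists v; rewrite ?inE // in vS *.
    apply: leq_trans (_ : 1 + #|S0| <= _); last by lia.
    rewrite cardsU1 leq_add ?leq_b1 //.
    exact: leq_trans (label_le_omega (g := g \o Some) gG0) (toughG _ S0n0).
  (* Now [S] contains no vertex of [G]: by connectivity all of [G] has the label of [x], and so has
     the new vertex if it is outside [S]. *)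
  have inS v : Some v \notin S by have /setP/(_ v) := S00; rewrite !inE => ->.
  have gx v : g (Some v) = g (Some x).
    apply: (connect_invariant (f := g \o Some)) (Gconn v x) => u w uw.
    by apply: gG0 uw; rewrite !inE.
  apply: leq_trans (_ : #|[set g (Some x)]| <= _); last by rewrite cards1; lia.
  apply: subset_leq_card; apply/subsetP=> _ /imsetP[[v|] vS ->]; rewrite inE ?gx //.
  by apply/eqP/gG; rewrite ?inE //= -?in_setC.
Qed.
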